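(* Let $\mathcal N$ be a network (with a general collision profile) of character $D^*$. For every integer $T\ge\max(2D^*,1)$, $\mathcal R^{(\mathcal M_T,\mathcal E_T)}\subseteq\mathcal R^{\mathcal N}$ (and hence $\mathcal R^{\mathcal N}=\mathcal R^{(\mathcal M_T,\mathcal E_T)}$).
   Context: A network is a triple $\mathcal N=(\mathcal L,\mathcal I,D_{\mathcal L})$ where $\mathcal L$ is a finite nonempty set of links, each $\mathcal I(l)$ is a collection of nonempty subsets of $\mathcal L$, and $D_{\mathcal L}$ assigns an integer $D_{\mathcal L}(l,l')$ to every pair with $l'\in\phi$ for some $\phi\in\mathcal I(l)$. The character is $D^*=\max_{l}\max_{\phi\in\mathcal I(l)}\max_{l'\in\phi}|D_{\mathcal L}(l,l')|$ (0 if there are no collision sets). A schedule is a map $S:\mathcal L\times\mathbb Z\to\{0,1\}$; $S(l,t)$ has a collision if there is $\phi\in\mathcal I(l)$ with $S(l',t+D_{\mathcal L}(l,l'))=1$ for all $l'\in\phi$; $S$ is collision free if no $(l,t)$ with $S(l,t)=1$ has a collision. $R_S(l)=\lim_{T\to\infty}\frac1T\sum_{t=0}^{T-1}\iota\big(S(l,t)=1\text{ and collision free}\big)$ when it exists; $R_S=(R_S(l))_l$. A nonnegative vector $R\in[0,\infty)^{\mathcal L}$ is achievable if for every $\epsilon>0$ some schedule $S$ has a rate vector with $R_S(l)\ge R(l)-\epsilon$ for all $l$; $\mathcal R^{\mathcal N}$ is the set of achievable nonnegative vectors. $S[T,k]$ is the $|\mathcal L|\times T$ binary matrix with $S[T,k](l,j)=S(l,kT+j)$.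 The scheduling graph $(\mathcal M_T,\mathcal E_T)$ has vertex set $\mathcal M_T$ = all $|\mathcal L|\times T$ binary matrices $A$ with $A=S[T,0]$ for some collision-free schedule $S$, and edge set $\mathcal E_T$ = all pairs $(A,B)$ with $A=S[T,0]$, $B=S[T,1]$ for some collision-free $S$. A cycle is a sequence $(A_0,\dots,A_k)$, $k\ge1$, with $(A_i,A_{i+1})\in\mathcal E_T$, $A_k=A_0$, and $A_0,\dots,A_{k-1}$ pairwise distinct; its rate vector is $R_C=\frac{1}{kT}\sum_{i=0}^{k-1}A_i\mathbf 1$. $\mathcal R^{(\mathcal M_T,\mathcal E_T)}$ is the convex hull of the rate vectors of all cycles. *)

(* Defs.v *)
From HB Require Import structures.
From mathcomp Require Import all_boot all_order all_algebra.
From mathcomp Require Import all_classical all_reals.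
From mathcomp Require Import topology normedtype sequences.
Set Implicit Arguments. Unset Strict Implicit. Unset Printing Implicit Defensive.
Import Order.TTheory GRing.Theory Num.Theory.
Import numFieldNormedType.Exports.
Local Open Scope ring_scope.
Local Open Scope classical_set_scope.

(* A network N = (L, I, D_L) is given by:
   - L : finType (the links; nonemptiness is a hypothesis of the theorem),
   - I : L -> {set {set L}}  (the collision sets of each link; each must be
     nonempty, a hypothesis of the theorem),
   - D : L -> L -> int (the offsets; only the values D l l' with l' in some
     phi in I l are ever used). *)

Section Network.
Variables (L : finType) (I : L -> {set {set L}}) (D : L -> L -> int).

(* Character D^* (0 when there are no collision sets). *)
Definition character : nat :=
  \max_(l : L) \max_(phi in I l) \max_(l' in phi) absz (D l l').

Definition schedule := L -> int -> bool.

Definition collision (S : schedule) (l : L) (t : int) : bool :=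
  [exists phi in I l, [forall l' in phi, S l' (t + D l l')]].

Definition collision_free (S : schedule) : Prop :=
  forall l t, S l t -> ~~ collision S l t.

Definition success (S : schedule) (l : L) (t : int) : bool :=
  S l t && ~~ collision S l t.

Variable R : realType.

Definition avg_success (S : schedule) (l : L) (n : nat) : R :=
  (n%:R)^-1 * \sum_(0 <= t < n) ((success S l t%:Z)%:R : R).

Definition has_rate (S : schedule) (l : L) (r : R) : Prop :=
  avg_success S l @ \oo --> r.

Definition achievable : set (L -> R) :=
  [set Rv | (forall l, 0 <= Rv l) /\
     forall eps : R, 0 < eps ->
       exists S : schedule, forall l, exists r, has_rate S l r /\ Rv l - eps <= r].

Definition mat (T : nat) := {ffun L * 'I_T -> bool}.

Definition block (S : schedule) (T k : nat) : mat T :=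
  [ffun p => S p.1 ((k * T + nat_of_ord p.2)%N)%:Z].

Definition vertex (T : nat) (A : mat T) : Prop :=
  exists S, collision_free S /\ A = block S T 0.

Definition edge (T : nat) (A B : mat T) : Prop :=
  exists S, collision_free S /\ A = block S T 0 /\ B = block S T 1.

(* A cycle (A_0,...,A_k) with A_k = A_0 is represented by the sequence
   c = [:: A_0; ...; A_{k-1}] (k = size c >= 1, pairwise distinct), with
   (A_i, A_{i+1 mod k}) in E_T. *)
Definition is_cycle (T : nat) (c : seq (mat T)) : Prop :=
  (0 < size c)%N /\ uniq c /\
  forall i, (i < size c)%N ->
    edge (nth (block (fun _ _ => false) T 0) c i)
         (nth (block (fun _ _ => false) T 0) c ((i.+1) %% size c)).

Definition cycle_rate (T : nat) (c : seq (mat T)) : L -> R :=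
  fun l => ((size c * T)%N%:R)^-1 *
           \sum_(A <- c) \sum_(j < T) ((A (l, j))%:R : R).

Definition graph_region (T : nat) : set (L -> R) :=
  [set Rv | exists (n : nat) (w : 'I_n -> R) (c : 'I_n -> seq (mat T)),
     (forall i, 0 <= w i) /\ \sum_(i < n) w i = 1 /\
     (forall i, is_cycle (c i)) /\
     Rv = (fun l => \sum_(i < n) w i * cycle_rate (c i) l)].

End Network.

(* Main.v *)
Require Import Defs.
From HB Require Import structures.
From mathcomp Require Import all_boot all_order all_algebra.
From mathcomp Require Import all_classical all_reals.
From mathcomp Require Import topology normedtype sequences derive.
From mathcomp Require Import zify ring lra.
Import Order.TTheory GRing.Theory Num.Theory.
Import numFieldNormedType.Exports.
Local Open Scope classical_set_scope.

(* A window of radius D^* meets at most two consecutive blocks of length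
   T >= 2 D^*, so gluing the blocks along any bi-infinite walk of the scheduling
   graph gives a collision-free schedule.  The zero block is joined both ways to
   every vertex; a closed walk can therefore run through any cycles with
   prescribed multiplicities at the cost of one extra block per cycle, and every
   convex combination of cycle rates is approached.  Conversely, the successes of
   a schedule form a collision-free schedule, and deleting transmissions adjusts
   its empirical rates over a long horizon to the given vector.  The walk of its
   blocks splits into cycles and a remainder without repetition, so the vector is
   a limit of points of the hull of the finitely many cycle rates, a compact set. *)

(** * Locality and monotonicity of collisions *)

Section Scheduling.
Local Open Scope ring_scope.
Context {L : finType} (I : L -> {set {set L}}) (D : L -> L -> int).
Implicit Types (S : schedule L) (l : L).

Local Notation cf := (collision_free I D).
Local Notation coll := (collision I D).

Lemma absz_le_character {l l'} {phi : {set L}} :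
  phi \in I l -> l' \in phi -> (`|D l l'| <= character I D)%N.
Proof.
move=> lphi l'phi; rewrite /character.
apply: (bigop.bigmax_sup l) => //; apply: (bigop.bigmax_sup phi) => //.
exact: (bigop.bigmax_sup l').
Qed.

(** A collision at [t] reads only times [t + D l l'] with [l'] in a collision set of [l], all within
    the character of [t]. *)
Lemma eq_collision_window S S' l (t : int) :
  (forall l' (s : int), `|s - t| <= (character I D)%:Z -> S l' s = S' l' s) ->
  coll S l t = coll S' l t.
Proof.
move=> SS'; apply: eq_existsb => phi; case: (boolP (phi \in I l)) => //= lphi.
apply: eq_forallb => l'; case: (boolP (l' \in phi)) => //= l'phi.
apply: SS'; have := absz_le_character lphi l'phi; lia.
Qed.

(** A collision asks only for transmissions, never for silence, so deleting transmissions creates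
    none. *)
Lemma collision_monotone {S S' : schedule L} : (forall l t, S l t -> S' l t) ->
  forall l t, coll S l t -> coll S' l t.
Proof.
move=> SS' l t /existsP [phi /andP [lphi /forallP H]].
apply/existsP; exists phi; rewrite lphi /=; apply/forallP => l'.
by have := H l'; case: (l' \in phi) => //=; exact: SS'.
Qed.

Lemma collision_free_sub {S S' : schedule L} :
  (forall l t, S l t -> S' l t) -> cf S' -> cf S.
Proof.
move=> SS' cfS' l t Slt; apply: contra (cfS' l t (SS' _ _ Slt)).
exact: collision_monotone.
Qed.

Lemma collision_free_success S : cf (success I D S).
Proof.
move=> l t /andP [_]; apply: contra; apply: collision_monotone.
by move=> l' t' /andP [].
Qed.

Lemma success_collision_free S l t : cf S -> success I D S l t = S l t.
Proof. by rewrite /success => /(_ l t); case: (S l t) => //= ->. Qed.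

Definition shift_schedule S (a : int) : schedule L := fun l t => S l (t + a).

Lemma collision_free_shift S a : cf S -> cf (shift_schedule S a).
Proof.
move=> cfS l t /cfS; apply: contra => /existsP [phi /andP [lphi /forallP H]].
apply/existsP; exists phi; rewrite lphi /=; apply/forallP => l'.
by have := H l'; rewrite /shift_schedule addrAC.
Qed.

(** * Edges of the scheduling graph and the zero block *)

Variable T : nat.

Lemma edge_block S k : cf S -> edge I D (block S T k) (block S T k.+1).
Proof.
move=> cfS; exists (shift_schedule S (k * T)%N%:Z); split; first exact: collision_free_shift.
by split; apply/ffunP => -[l j]; rewrite !ffunE /shift_schedule /=; congr (S l _); lia.
Qed.

Definition zero_block : mat L T := block (fun _ _ => false) T 0.

Lemma zero_blockE p : zero_block p = false.
Proof. by rewrite ffunE. Qed.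

Lemma edge_to_zero A : vertex I D A -> edge I D A zero_block.
Proof.
(* Silencing [S] from time [T] on keeps block 0 and empties block 1. *)
move=> [S [cfS ->]]; exists (fun l t => S l t && (t < T%:Z)).
split; first by apply: collision_free_sub cfS => l t /andP [].
split; apply/ffunP => -[l j]; rewrite !ffunE /=.
  by have := ltn_ord j; rewrite mul0n add0n ltz_nat => ->; rewrite andbT.
by rewrite ltz_nat mul1n ltnNge leq_addr andbF.
Qed.

Lemma edge_from_zero A : vertex I D A -> edge I D zero_block A.
Proof.
move=> [S [cfS ->]].
(* [S] is silenced before time 0 and then delayed by [T], which moves its block 0 to block 1. *)
exists (shift_schedule (fun l t => S l t && (0 <= t)) (- T%:Z)).
split.
  apply: collision_free_shift.
  by apply: collision_free_sub cfS => l t /andP [].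
split; apply/ffunP => -[l j]; rewrite !ffunE /shift_schedule /=.
  by have := ltn_ord j => jT; symmetry; apply/andP => -[_]; lia.
have -> : (1 * T + j)%N%:Z + - T%:Z = (0 * T + j)%N%:Z by lia.
by rewrite lez_nat leq0n andbT.
Qed.

Lemma vertex_zero : vertex I D zero_block.
Proof. by exists (fun _ _ => false); split => // l t. Qed.

Lemma edge_zero_zero : edge I D zero_block zero_block.
Proof. exact: edge_to_zero vertex_zero. Qed.

Lemma edge_vertexl (A B : mat L T) : edge I D A B -> vertex I D A.
Proof. by move=> [S [cfS [-> _]]]; exists S. Qed.

(** * Gluing blocks along a bi-infinite walk *)

Definition mat_at (A : mat L T) l (j : nat) : bool :=
  if insub j is Some i then A (l, i) else false.

Lemma mat_at_ord A l (i : 'I_T) : mat_at A l i = A (l, i).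
Proof. by rewrite /mat_at valK. Qed.

Definition glue_blocks (a : int -> mat L T) : schedule L :=
  fun l t => mat_at (a (t %/ T)%Z) l `|(t %% T)%Z|.

Lemma glue_blocksE a l (k : int) (j : 'I_T) : glue_blocks a l (k * T%:Z + j%:Z) = a k (l, j).
Proof.
have T0 : T%:Z != 0 by have := ltn_ord j; lia.
rewrite /glue_blocks divzMDl // modzMDl.
by rewrite divz_small ?modz_small ?addr0 ?mat_at_ord //; have := ltn_ord j; lia.
Qed.

(** The edge joining the two blocks met by the window comes from a single collision-free schedule;
    up to a shift it agrees with the glued one on the whole window, so it decides the collision. *)
Lemma collision_free_glue_blocks (a : int -> mat L T) :
  (maxn (2 * character I D) 1 <= T)%N ->
  (forall k : int, edge I D (a k) (a (k + 1))) -> cf (glue_blocks a).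
Proof.
move=> HT ea l t at1.
set c := character I D in HT *.
have T0 : (0 < T)%N by lia.
(* The block of the left end of the window: as [2 * c <= T], the window stays inside blocks [k] and
   [k + 1]. *)
set k := ((t - c%:Z) %/ T)%Z.
have [S [cfS [eA eB]]] := ea k.
have k1 : (k * T <= t - c%:Z)%R by apply: lez_floor; lia.
have k2 : (t - c%:Z < (k + 1) * T)%R by apply: ltz_ceil; lia.
have aS l' (s : int) : `|s - t| <= c%:Z -> glue_blocks a l' s = shift_schedule S (- (k * T)) l' s.
  move=> st; pose m := (s %/ T)%Z.
  have r0 : 0 <= (s %% T)%Z by apply: modz_ge0; lia.
  have r1 : (s %% T)%Z < T%:Z by apply: ltz_pmod; lia.
  have sE := divz_eq s T.
  have jT : (`|(s %% T)%Z| < T)%N by lia.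
  pose j := Ordinal jT.
  have {}sE : s = m * T%:Z + j%:Z by rewrite /m /=; lia.
  have : m = k \/ m = k + 1.
    have : k * T < (m + 1) * T by rewrite mulrDl mul1r; have /= := ltn_ord j; lia.
    have : m * T < (k + 1 + 1) * T by rewrite mulrDl mul1r; lia.
    rewrite !ltr_pM2r //; lia.
  rewrite sE glue_blocksE /shift_schedule => -[] ->.
    by rewrite eA ffunE /=; congr (S l' _); lia.
  by rewrite eB ffunE /=; congr (S l' _); lia.
rewrite (eq_collision_window _ (shift_schedule S (- (k * T)))) //.
by apply: (collision_free_shift _ _ cfS); rewrite -aS // subrr normr0.
Qed.

(** * Closed walks, and the splitting of a walk into cycles *)

Definition edgeb (A B : mat L T) : bool := `[< edge I D A B >].

(** [path.cycle] closes a list by appending its head, which is the wrap-around of the index modulo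
    the length. *)
Lemma cycle_edgebP (c : seq (mat L T)) : path.cycle edgeb c <->
  forall i, (i < size c)%N ->
    edge I D (nth zero_block c i) (nth zero_block c (i.+1 %% size c)).
Proof.
case: c => [|x p]; first by split.
rewrite /path.cycle; set c := x :: p.
have nE i : (i < size c)%N ->
    nth zero_block (x :: rcons p x) i = nth zero_block c i /\
    nth zero_block (rcons p x) i = nth zero_block c (i.+1 %% size c).
  move=> ip; split; first by rewrite -rcons_cons nth_rcons -/c ip.
  move: ip; rewrite /c /= nth_rcons.
  case: (ltngtP i (size p)) => [ip _|ip ip'|-> _].
  - by rewrite modn_small.
  - by move: ip ip'; lia.
  - by rewrite modnn.
split=> [/(pathP zero_block) H i ip|H].
  have [<- <-] := nE _ ip; apply/asboolP; apply: H.
  by rewrite size_rcons.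
apply/(pathP zero_block) => i; rewrite size_rcons => ip; apply/asboolP.
by have [-> ->] := nE _ ip; exact: H.
Qed.

Lemma is_cycleE (c : seq (mat L T)) :
  is_cycle I D c <-> [/\ (0 < size c)%N, uniq c & path.cycle edgeb c].
Proof.
split=> [[c0 [cu cc]]|[c0 cu cc]]; first by split => //; exact/cycle_edgebP.
by do 2?split => //; exact/cycle_edgebP.
Qed.

Lemma cycle_vertex {s : seq (mat L T)} {A} :
  path.cycle edgeb s -> A \in s -> vertex I D A.
Proof.
move=> cs /(nthP zero_block) [i si <-].
exact: edge_vertexl ((cycle_edgebP s).1 cs i si).
Qed.

Lemma is_cycle_zero : is_cycle I D [:: zero_block].
Proof. by apply/is_cycleE; split => //=; rewrite andbT; apply/asboolP/edge_zero_zero. Qed.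

(** [A] may lie outside [c]: it only needs an edge to the head of [c]. The last block of [c] has one
    too, so each new turn can start. *)
Lemma path_nseq_cycle q (A : mat L T) (c : seq (mat L T)) :
  path.cycle edgeb c -> path edgeb A c -> path edgeb A (flatten (nseq q c)).
Proof.
case: c => [|x p] cc; first by elim: q.
elim: q A => //= q IH A; rewrite cat_path => /andP [-> /= pp]; rewrite pp /=.
by apply: IH; move: cc; rewrite (cycle_path A).
Qed.

Lemma last_flatten_nseq q (A : mat L T) (c : seq (mat L T)) :
  last A (flatten (nseq q c)) \in A :: c.
Proof.
have := mem_last A (flatten (nseq q c)); rewrite !inE => /orP [->//|].
by move=> /flattenP [s]; rewrite mem_nseq => /andP [_ /eqP ->] ->; rewrite orbT.
Qed.

(** The connecting zero blocks carry no transmission and number [n + 1], whatever the multiplicities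
    [q]. *)
Definition tour (n : nat) (q : 'I_n -> nat) (c : 'I_n -> seq (mat L T)) :=
  zero_block ::
    flatten [seq rcons (flatten (nseq (q i) (c i))) zero_block | i <- enum 'I_n].

Lemma cycle_tour n q (c : 'I_n -> seq (mat L T)) :
  (forall i, path.cycle edgeb (c i)) -> path.cycle edgeb (tour n q c).
Proof.
move=> cc; rewrite (cycle_path zero_block) /tour.
set z := zero_block.
pose fl := fun e : seq 'I_n => flatten [seq rcons (flatten (nseq (q i) (c i))) z | i <- e].
rewrite -/(fl _).
(* Starting and ending at the zero block is stable under concatenation, which allows induction on
   the list of indices. *)
suff H e : path edgeb z (fl e) && (last z (fl e) == z).
  have /andP [pz /eqP lz] := H (enum 'I_n).
  by rewrite /= lz pz andbT; apply/asboolP/edge_zero_zero.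
elim: e => [|i e IH]; first by rewrite /= eqxx.
rewrite /fl /= cat_path last_cat last_rcons -/(fl e) -andbA IH andbT rcons_path.
apply/andP; split.
  apply: path_nseq_cycle => //; have := cc i; case E : (c i) => [//|x p].
  rewrite /= rcons_path => cx; apply/andP; split; last by case/andP: cx.
  apply/asboolP/edge_from_zero/(cycle_vertex (cc i)).
  by rewrite E mem_head.
apply/asboolP/edge_to_zero; have := last_flatten_nseq (q i) z (c i).
rewrite inE => /orP [/eqP ->|]; first exact: vertex_zero.
exact: cycle_vertex.
Qed.

(** Induction from the end of the walk. If the repetition-free remainder already contains the new
    block [A], the stretch before that occurrence closes into a cycle with [A], and what follows,
    again starting at [A], is the new remainder. *)
Lemma path_cycle_decomposition A (s : seq (mat L T)) : path edgeb A s ->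
  exists (cs : seq (seq (mat L T))) u,
    [/\ (forall c, c \in cs -> is_cycle I D c), uniq (A :: u),
        path edgeb A u & perm_eq (A :: s) (flatten cs ++ A :: u)].
Proof.
elim: s A => [|B s IH] A; first by move=> _; exists [::], [::].
move=> /= /andP [eAB /IH [cs [u [csC uu pu su]]]].
have pA : path edgeb A (B :: u) by rewrite /= eAB.
have [Au|Au] := boolP (A \in B :: u); last first.
  exists cs, (B :: u); split=> //; first by rewrite cons_uniq Au.
  apply: (perm_trans (y := [:: A] ++ flatten cs ++ B :: u)).
    by rewrite /= perm_cons.
  by rewrite perm_catCA.
move: uu pA su; case/splitPr: Au => a b uu pA su.
move: pA; rewrite cat_path /= => /and3P [pa la pb].
move: uu; rewrite cat_uniq /= => /and3P [ua]; rewrite negb_or => /andP [Aa _] /andP [Ab ub].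
exists ((A :: a) :: cs), b; split=> //.
- move=> c; rewrite inE => /orP [/eqP ->|]; last exact: csC.
  apply/is_cycleE; split=> //; first by rewrite cons_uniq Aa.
  by rewrite /path.cycle rcons_path pa.
- by rewrite /= Ab.
- by rewrite /= perm_cons (perm_trans su) // perm_catCA -catA.
Qed.

End Scheduling.

(** * Means of periodic sequences *)

Section Rates.
Local Open Scope ring_scope.
Context {R : realType}.

Lemma sum_periodic (f : nat -> R) P q : (forall t, f (t + P)%N = f t) ->
  \sum_(0 <= t < q * P) f t = q%:R * \sum_(0 <= t < P) f t.
Proof.
move=> fP; have fqP k t : f (t + k * P)%N = f t.
  by elim: k => [|k IH]; rewrite ?addn0 // mulSn addnCA addnC fP.
elim: q => [|q IH]; first by rewrite mul0n big_geq // mul0r.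
rewrite mulSn (@big_cat_nat _ _ _ (q * P)) ?leq_addl //= IH.
rewrite -{1}[(q * P)%N]add0n big_addn addnK.
under eq_bigr do rewrite fqP.
by rewrite -addn1 natrD mulrDl mul1r.
Qed.

(** Whole periods contribute exactly their mean [a] per step, so the partial sum stays within [P] of
    [n%:R * a]. *)
Lemma cvg_mean_periodic (f : nat -> R) P : (0 < P)%N ->
  (forall t, f (t + P)%N = f t) -> (forall t, 0 <= f t <= 1) ->
  (fun n => n%:R^-1 * \sum_(0 <= t < n) f t) @ \oo -->
    P%:R^-1 * \sum_(0 <= t < P) f t.
Proof.
move=> P0 fP f01; set a := P%:R^-1 * _.
have PR : 0 < P%:R :> R by rewrite ltr0n.
have sb n : 0 <= \sum_(0 <= t < n) f t <= n%:R.
  rewrite big_mkord sumr_ge0 => [|i _]; last by case/andP: (f01 i).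
  rewrite -[n in n%:R]card_ord -sum1_card natr_sum ler_sum // => i _.
  by case/andP: (f01 i).
have a01 : 0 <= a <= 1.
  have /andP [s0 s1] := sb P.
  by rewrite /a mulrC divr_ge0 ?ler0n //= ler_pdivrMr // mul1r.
have bound n : `|\sum_(0 <= t < n) f t - n%:R * a| <= P%:R.
  rewrite {1 2}(divn_eq n P).
  set q := (n %/ P)%N; set r := (n %% P)%N.
  have rP : r%:R <= P%:R :> R by rewrite ler_nat ltnW // ltn_pmod.
  have fqP t : f (t + q * P)%N = f t.
    by elim: q => [|k IH]; rewrite ?addn0 // mulSn addnCA addnC fP.
  rewrite (@big_cat_nat _ _ _ (q * P)) ?leq_addr //= sum_periodic //.
  rewrite -{1}[(q * P)%N]add0n big_addn addKn.
  under [X in _ + X - _]eq_bigr do rewrite fqP.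
  rewrite natrD natrM mulrDl -mulrA [P%:R * a]mulrA divff ?gt_eqF // mul1r.
  rewrite opprD addrACA subrr add0r.
  have /andP [s0 s1] := sb r; case/andP: a01 => a0 a1.
  have r0 : 0 <= r%:R :> R by rewrite ler0n.
  have ra0 : 0 <= r%:R * a by rewrite mulr_ge0.
  have ra1 : r%:R * a <= r%:R by rewrite ler_piMr.
  rewrite ler_norml; lra.
apply/cvgrPdist_le => e e0; near=> n.
have n0 : 0 < n%:R :> R by rewrite ltr0n; near: n; exact: nbhs_infty_gt.
rewrite distrC -(ler_pM2l n0) -{1}[n%:R]gtr0_norm // -normrM mulrBr mulrA divff ?gt_eqF // mul1r.
apply: (le_trans (bound n)); rewrite -ler_pdivrMr //.
near: n; exact: nbhs_infty_ger.
Unshelve. all: by end_near. Qed.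

(** * Rates of periodic schedules *)

Context {L : finType} (I : L -> {set {set L}}) (D : L -> L -> int).
Variable T : nat.
Hypothesis HT : (maxn (2 * character I D) 1 <= T)%N.

Let T0 : (0 < T)%N. Proof. by move: HT; rewrite geq_max => /andP []. Qed.

Lemma sum_blocks (S : schedule L) l m :
  \sum_(0 <= t < m * T) (S l t%:Z)%:R =
  \sum_(k < m) \sum_(j < T) (block S T k (l, j))%:R :> R.
Proof.
rewrite big_nat_mul big_mkord; apply: eq_bigr => k _.
rewrite -{1}[(k * T)%N]add0n mulSn big_addn addnK big_mkord.
by apply: eq_bigr => j _; rewrite ffunE /= addnC.
Qed.

Lemma block_glue_blocks (a : int -> mat L T) (k : nat) : block (glue_blocks T a) T k = a k.
Proof.
by apply/ffunP => -[l j]; rewrite ffunE /= PoszD PoszM glue_blocksE.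
Qed.

(** For nonempty [s] the remainder is nonnegative even at negative [k]; the absolute value then only
    changes the type. *)
Definition loop_blocks (s : seq (mat L T)) : int -> mat L T :=
  fun k => nth (zero_block T) s `|(k %% (size s)%:Z)%Z|.

Lemma collision_free_loop s : (0 < size s)%N -> path.cycle (edgeb I D T) s ->
  collision_free I D (glue_blocks T (loop_blocks s)).
Proof.
move=> s0 cs; apply: collision_free_glue_blocks => // k.
set m := `|(k %% (size s)%:Z)%Z|%N.
have k0 : 0 <= (k %% (size s)%:Z)%Z by apply: modz_ge0; lia.
have k1 : (k %% (size s)%:Z)%Z < (size s)%:Z by apply: ltz_pmod; lia.
have ms : (m < size s)%N by lia.
have := (cycle_edgebP I D T s).1 cs m ms.
suff <- : `|((k + 1) %% (size s)%:Z)%Z|%N = (m.+1 %% size s)%N by [].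
rewrite -modzDml.
have -> : ((k %% size s)%Z + 1 = m.+1%:Z)%R by lia.
by rewrite modz_nat.
Qed.

(** [s] may repeat blocks, so tours are covered. The looped schedule has period [size s * T], and
    all its transmissions succeed. *)
Lemma has_rate_loop s l : (0 < size s)%N -> path.cycle (edgeb I D T) s ->
  has_rate I D (glue_blocks T (loop_blocks s)) l (cycle_rate R s l).
Proof.
move=> s0 cs; rewrite /has_rate.
set S := glue_blocks T (loop_blocks s).
have -> : avg_success I D R S l =
    fun n => n%:R^-1 * \sum_(0 <= t < n) (S l t%:Z)%:R.
  apply/funext => n; rewrite /avg_success; congr (_ * _).
  apply: eq_bigr => t _; rewrite success_collision_free //.
  exact: collision_free_loop.
have -> : cycle_rate R s l =
    (size s * T)%:R^-1 * \sum_(0 <= t < size s * T) (S l t%:Z)%:R.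
  rewrite sum_blocks /cycle_rate; congr (_ * _).
  rewrite (big_nth (zero_block T)) big_mkord; apply: eq_bigr => k _.
  by rewrite block_glue_blocks /loop_blocks modz_small // ltz_nat ltn_ord.
apply: (cvg_mean_periodic (fun t => (S l t%:Z)%:R)); first by rewrite muln_gt0 s0.
  move=> t; congr ((nat_of_bool _)%:R).
  rewrite /S /glue_blocks /loop_blocks PoszD PoszM.
  have TZ : T%:Z != 0 by move: T0; lia.
  by rewrite addrC divzMDl // modzMDl modzDl.
by move=> t; case: (S l t); rewrite /= ?lexx ?ler01.
Qed.

End Rates.

(** * From convex combinations of cycles to schedules *)

Section Regions.
Local Open Scope ring_scope.
Context {R : realType} {L : finType} (I : L -> {set {set L}}) (D : L -> L -> int).
Variable T : nat.
Hypothesis HT : (maxn (2 * character I D) 1 <= T)%N.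

Let T0 : (0 < T)%N. Proof. by move: HT; rewrite geq_max => /andP []. Qed.

Local Notation region := (@graph_region L I D R T).
Local Notation achievable_set := (@achievable L I D R).
Local Notation z := (@zero_block L T).

Let g (l : L) (A : mat L T) : R := \sum_(j < T) (A (l, j))%:R.

Let g_zero l : g l z = 0.
Proof. by rewrite /g big1 // => j _; rewrite zero_blockE. Qed.

Let g_ge0 l A : 0 <= g l A.
Proof. by apply: sumr_ge0 => j _; rewrite ler0n. Qed.

Let g_le l A : g l A <= T%:R.
Proof.
rewrite /g -[T in T%:R]card_ord -sum1_card natr_sum ler_sum // => j _.
by rewrite lern1 leq_b1.
Qed.

Lemma cycle_rate_ge0 (c : seq (mat L T)) l : 0 <= cycle_rate R c l.
Proof.
by rewrite /cycle_rate mulr_ge0 ?invr_ge0 ?ler0n // sumr_ge0 // => A _; exact: g_ge0.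
Qed.

Lemma sum_cycle_rate (c : seq (mat L T)) l : (0 < size c)%N ->
  \sum_(A <- c) \sum_(j < T) (A (l, j))%:R = (size c)%:R * T%:R * cycle_rate R c l.
Proof.
by move=> c0; rewrite /cycle_rate -natrM mulrA divff ?mul1r // pnatr_eq0 -lt0n muln_gt0 c0.
Qed.

(** The free weight [h] serves twice: [h = 1] counts the blocks of the tour, [h = g l] the
    transmissions of [l]. *)
Lemma sum_tour n q (c : 'I_n -> seq (mat L T)) (h : mat L T -> R) :
  \sum_(A <- tour T n q c) h A =
  h z + \sum_(i < n) ((q i)%:R * \sum_(A <- c i) h A + h z).
Proof.
rewrite /tour big_cons; congr (_ + _).
rewrite big_flatten /= big_map big_enum /=; apply: eq_bigr => i _.
rewrite -cats1 big_cat big_seq1 /=; congr (_ + _).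
elim: (q i) => [|k IH]; first by rewrite /= big_nil mul0r.
by rewrite /= big_cat /= IH -[in RHS]addn1 natrD mulrDl mul1r addrC.
Qed.

Lemma graph_region_ge0 {Rv : L -> R} l : region Rv -> 0 <= Rv l.
Proof.
move=> [n [w [c [w0 [_ [_ ->]]]]]]; apply: sumr_ge0 => i _.
by rewrite mulr_ge0 ?cycle_rate_ge0.
Qed.

(** With [q i] close to [N * w i / K i], cycle [i] fills about [N * w i] blocks of the tour.
    Rounding and zero blocks cost an amount independent of [N]. *)
Lemma graph_region_achievable : region `<=` achievable_set.
Proof.
move=> Rv RvG; split; first by move=> l; exact: graph_region_ge0.
move=> eps eps0; have Rv0 l := graph_region_ge0 l RvG.
case: RvG => n [w [c [w0 [w1 [cC RvE]]]]].
have c0 i : (0 < size (c i))%N by have [] := cC i.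
have ccyc i : path.cycle (edgeb I D T) (c i) by have /is_cycleE [] := cC i.
pose K i : R := (size (c i))%:R.
have K0 i : 0 < K i by rewrite ltr0n.
(* [C l] bounds the loss from rounding: at most one turn of each cycle. *)
pose C l := \sum_(i < n) K i * cycle_rate R (c i) l.
(* Beyond [M l], the slack [eps * N] absorbs both [C l] and the [n + 1] zero blocks; the sum of [M]
   over the links gives one [N] for all of them. *)
pose M l := (Rv l * n.+1%:R + C l) / eps.
have M0 l : 0 <= M l.
  apply: divr_ge0; last exact: ltW.
  apply: addr_ge0; first by rewrite mulr_ge0.
  by apply: sumr_ge0 => i _; rewrite mulr_ge0 ?cycle_rate_ge0 // ltW.
pose N := Num.bound (\sum_l M l).
have MN l : Rv l * n.+1%:R + C l <= eps * N%:R.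
  rewrite [leRHS]mulrC -ler_pdivrMr // -/(M l) ltW //.
  have MS : 0 <= \sum_l M l by exact: sumr_ge0.
  apply: le_lt_trans (archi_boundP MS).
  by rewrite (bigD1 l) //= lerDl sumr_ge0.
pose q i := Num.truncn (N%:R * w i / K i).
have qK i : (q i)%:R * K i <= N%:R * w i <= (q i)%:R * K i + K i.
  have /truncn_itv /andP [q1 q2] : 0 <= N%:R * w i / K i.
    by rewrite divr_ge0 ?mulr_ge0 ?ler0n // ltW.
  rewrite -ler_pdivlMr // q1 /=; apply: ltW.
  by move: q2; rewrite ltr_pdivrMr // -natr1 mulrDl mul1r.
pose s := tour T n q c.
have s0 : (0 < size s)%N by [].
have scyc : path.cycle (edgeb I D T) s by exact: cycle_tour.
exists (glue_blocks T (loop_blocks T s)) => l; exists (cycle_rate R s l).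
split; first exact: has_rate_loop.
(* For [Rv l <= eps] nonnegativity of the rate suffices. Otherwise [Rv l - eps] is positive and may
   multiply the bound [s_le]. *)
have [Rle|Rgt] := leP (Rv l) eps.
  by apply: (le_trans _ (cycle_rate_ge0 s l)); rewrite subr_le0.
have sE : (size s)%:R = 1 + \sum_(i < n) ((q i)%:R * K i + 1) :> R.
  rewrite -sum1_size natr_sum (sum_tour _ _ _ (fun=> 1)); congr (_ + _).
  by apply: eq_bigr => i _; rewrite /K -sum1_size natr_sum.
have s_le : (size s)%:R <= n.+1%:R + N%:R :> R.
  rewrite sE big_split /= sumr_const card_ord -natr1.
  have : \sum_(i < n) (q i)%:R * K i <= \sum_(i < n) N%:R * w i.
    by apply: ler_sum => i _; case/andP: (qK i).
  rewrite -mulr_sumr w1; lra.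
have rE : (size s)%:R * T%:R * cycle_rate R s l =
    T%:R * \sum_(i < n) (q i)%:R * K i * cycle_rate R (c i) l.
  rewrite -sum_cycle_rate // (sum_tour _ _ _ (g l)) g_zero add0r mulr_sumr.
  apply: eq_bigr => i _; rewrite addr0 /g sum_cycle_rate // /K; ring.
have TR : 0 < T%:R :> R by rewrite ltr0n.
have sR : 0 < (size s)%:R :> R by rewrite ltr0n.
have {}rE : (size s)%:R * cycle_rate R s l =
    \sum_(i < n) (q i)%:R * K i * cycle_rate R (c i) l.
  have TN : T%:R != 0 :> R by rewrite gt_eqF.
  by apply: (mulfI TN); rewrite -rE; ring.
rewrite -(ler_pM2l sR) rE.
have qsum : \sum_(i < n) (N%:R * w i - K i) * cycle_rate R (c i) l <=
    \sum_(i < n) (q i)%:R * K i * cycle_rate R (c i) l.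
  apply: ler_sum => i _; apply: ler_wpM2r; first exact: cycle_rate_ge0.
  by rewrite lerBlDr; case/andP: (qK i).
apply: le_trans qsum.
have -> : \sum_(i < n) (N%:R * w i - K i) * cycle_rate R (c i) l =
    N%:R * Rv l - C l.
  rewrite RvE mulr_sumr /C -sumrB; apply: eq_bigr => i _; ring.
have : (size s)%:R * (Rv l - eps) <= (n.+1%:R + N%:R) * (Rv l - eps).
  by apply: ler_wpM2r => //; rewrite subr_ge0 ltW.
have : 0 <= eps * n.+1%:R by rewrite mulr_ge0 ?ler0n // ltW.
have := MN l; lra.
Qed.

(** * Closedness of the hull of the cycle rates *)

Lemma graph_region_seq (ps : seq (R * seq (mat L T))) :
  (forall p, p \in ps -> 0 <= p.1 /\ is_cycle I D p.2) ->
  \sum_(p <- ps) p.1 = 1 ->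
  region (fun l => \sum_(p <- ps) p.1 * cycle_rate R p.2 l).
Proof.
move=> psP ps1; pose p0 : R * seq (mat L T) := (0, [::]).
have psi (i : 'I_(size ps)) := psP _ (mem_nth p0 (ltn_ord i)).
exists (size ps), (fun i => (nth p0 ps i).1), (fun i => (nth p0 ps i).2).
split; first by move=> i; case: (psi i).
split; first by rewrite -ps1 (big_nth p0) big_mkord.
split; first by move=> i; case: (psi i).
by apply/funext => l; rewrite (big_nth p0) big_mkord.
Qed.

(* The distance to [Rv] attains its minimum on the simplex of weights over the
   finitely many cycles. *)
Lemma graph_region_closed (Rv : L -> R) :
  (forall eps : R, 0 < eps -> exists2 Rv', region Rv' &
     forall l, `|Rv l - Rv' l| <= eps) ->
  region Rv.
Proof.
move=> H.
(* A cycle has no repetition, so its length is at most the number of matrices; sequences so bounded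
   form a finite type, and the cycles can be enumerated. *)
pose B := #|{: mat L T}|.-bseq (mat L T).
pose P := [pred b : B | `[< is_cycle I D (b : seq (mat L T)) >]].
pose n := #|P|.
pose cyc (i : 'I_n) : seq (mat L T) := val (enum_val i : B).
have cycC i : is_cycle I D (cyc i) by have := enum_valP i => /asboolP.
pose pt (v : 'rV[R]_n) l := \sum_(i < n) v ord0 i * cycle_rate R (cyc i) l.
pose Delta := [set v : 'rV[R]_n | (forall i, v ord0 i \in `[0, 1]) /\
  \sum_(i < n) v ord0 i = 1].
have DeltaP Rv' : region Rv' -> exists2 v, Delta v & Rv' = pt v.
  move=> [m [w [c [w0 [w1 [cC ->]]]]]].
  have cB j : (size (c j) <= #|{: mat L T}|)%N.
    by have [_ [/card_uniqP <- _]] := cC j; exact: max_card.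
  pose b j : B := Bseq (cB j).
  have Pb j : b j \in P by apply/asboolP; exact: cC.
  (* Adding up the weights of equal cycles moves any convex combination onto the fixed
     enumeration. *)
  have vE (F : 'I_n -> R) :
      \sum_(i < n) (\sum_(j < m | b j == enum_val i) w j) * F i =
      \sum_(j < m) w j * F (enum_rank_in (Pb j) (b j)).
    under eq_bigr do rewrite mulr_suml.
    rewrite (exchange_big_dep predT) //=; apply: eq_bigr => j _.
    rewrite (big_pred1 (enum_rank_in (Pb j) (b j))) // => i /=.
    apply/eqP/eqP => [bE|->]; first by apply: enum_val_inj; rewrite enum_rankK_in.
    by rewrite enum_rankK_in.
  pose v : 'rV[R]_n := \row_i \sum_(j < m | b j == enum_val i) w j.
  exists v; last first.
    apply/funext => l; rewrite /pt; under [RHS]eq_bigr do rewrite mxE.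
    rewrite vE; apply: eq_bigr => j _.
    by rewrite /cyc enum_rankK_in.
  split.
    move=> i; rewrite mxE /= in_itv /=; apply/andP; split.
      by apply: sumr_ge0.
    by rewrite -w1 [leRHS](bigID (fun j => b j == enum_val i)) /= lerDl sumr_ge0.
  under eq_bigr do rewrite mxE.
  rewrite -[RHS]w1 -[LHS](eq_bigr _ (fun i _ => mulr1 _)) (vE (fun=> 1)).
  by apply: eq_bigr => j _; rewrite mulr1.
have ptG v : Delta v -> region (pt v).
  move=> [v01 v1]; exists n, (fun i => v ord0 i), cyc; split.
    by move=> i; have := v01 i; rewrite /= in_itv /= => /andP [].
  by [].
have sumc (h : 'I_n -> R) : continuous (fun v : 'rV[R]_n => \sum_(i < n) v ord0 i * h i).
  apply: continuous_big; first exact: add_continuous.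
  by move=> i _ v; apply: continuousM; [exact: coord_continuous|exact: cst_continuous].
have Dc : compact Delta.
  (* The simplex is a closed part of the unit cube. *)
  apply: (@subclosed_compact _ _ [set v : 'rV[R]_n | forall i, v ord0 i \in `[0, 1]]).
  - rewrite (_ : Delta = \bigcap_i ((fun v : 'rV[R]_n => v ord0 i) @^-1` [set` `[0, 1]]) `&`
        (fun v : 'rV[R]_n => \sum_(i < n) v ord0 i * 1) @^-1` [set 1]).
      apply: closedI.
        apply: closed_bigI => i _; apply: (continuous_closedP _).1.
          exact: coord_continuous.
        exact: interval_closed.
      apply: ((continuous_closedP _).1 (sumc (fun=> 1))).
      exact: closed_eq.
    apply/seteqP; split=> v [v01 v1]; split => /=.
    - by move=> i _; exact: v01.
    - by under eq_bigr do rewrite mulr1.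
    - by move=> i; exact: v01.
    - by move: v1 => /=; under eq_bigr do rewrite mulr1.
  - by apply: (@rV_compact R n (fun=> [set` `[0, 1]])) => i; exact: segment_compact.
  - by move=> v [].
(* The extreme value theorem asks for a point of [Delta]; any approximation of [Rv] supplies one. *)
have [Rv1 /DeltaP [v1 Dv1 _] _] := H 1 ltr01.
pose f v := \sum_l `|Rv l - pt v l|.
have fc : continuous f.
  apply: continuous_big; first exact: add_continuous.
  move=> l _ v; apply: (@continuous_comp _ _ _ (fun v => Rv l - pt v l) Num.norm).
    by apply: continuousB; [exact: cst_continuous|exact: sumc].
  exact: norm_continuous.
have [v Dv vmin] := EVT_min_rV (ex_intro _ _ Dv1) Dc (continuous_subspaceT fc).
rewrite inE in Dv.
suff f0 : f v <= 0.
  have -> : Rv = pt v; last exact: ptG.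
  apply/funext => l; apply/eqP; rewrite -subr_eq0 -normr_le0.
  apply: le_trans f0; rewrite /f (bigD1 l) //= lerDl; exact: sumr_ge0.
apply/ler_addgt0Pl => e e0; rewrite addr0.
(* With this tolerance per link, the errors sum to at most [e]. *)
have e1 : 0 < e / #|L|.+1%:R by rewrite divr_gt0 // ltr0n.
have [Rv' /DeltaP [v' Dv' ->] Rv'e] := H _ e1.
have := vmin v'; rewrite inE => /(_ Dv') /le_trans; apply.
apply: (@le_trans _ _ (\sum_(l : L) e / #|L|.+1%:R)); first exact: ler_sum.
rewrite sumr_const -[leLHS]mulr_natr mulrAC ler_pdivrMr ?ltr0n //.
by rewrite ler_pM2l // ler_nat.
Qed.

(** * From achievable vectors to points of the hull *)

(** A discrete intermediate value theorem: prefix sums of a boolean sequence grow by at most one per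
    step and skip no value. *)
Lemma exists_prefix_sum (f : nat -> bool) n m : (m <= \sum_(0 <= t < n) f t)%N ->
  exists2 k, (k <= n)%N & (\sum_(0 <= t < k) f t = m)%N.
Proof.
elim: n => [|n IH]; first by rewrite big_geq // leqn0 => /eqP ->; exists 0%N; rewrite ?big_geq.
have [mn _|mn] := leqP m (\sum_(0 <= t < n) f t).
  by have [k kn <-] := IH mn; exists k => //; exact: leqW.
move=> mn1; exists n.+1 => //; apply/eqP; rewrite eqn_leq mn1 andbT.
by rewrite big_nat_recr //=; case: (f n); lia.
Qed.

(* Deleting transmissions keeps a schedule collision free, so each link can be
   stopped as soon as it has used up its share of successes. *)
Lemma achievable_truncation {Rv : L -> R} (e : R) (n0 : nat) :
  achievable_set Rv -> 0 < e ->
  exists2 N, (n0 <= N)%N & exists2 S, collision_free I D S &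
    forall l, `|Rv l - (N * T)%:R^-1 * \sum_(0 <= t < N * T) (S l t%:Z)%:R| <= e.
Proof.
move=> [Rv0 RvA] e0.
have e2 : 0 < e / 2 by lra.
have [S Srate] := RvA _ e2.
have /choice [n1 n1P] : forall l, exists m, forall k, (m <= k)%N ->
    Rv l - e <= avg_success I D R S l k.
  move=> l; have [r [/cvgrPdist_le /(_ _ e2) [m _ mP] rl]] := Srate l.
  by exists m => k /mP /=; rewrite ler_norml => /andP [_]; lra.
(* The middle summand passes the threshold of every link; the last one gives [1 <= n%:R * e], which
   pays for rounding to whole transmissions. *)
pose N := (n0 + \sum_l n1 l + (Num.bound e^-1).+1)%N.
exists N; first by rewrite /N -addnA leq_addr.
set n := (N * T)%N.
have Nn : (N <= n)%N by rewrite leq_pmulr.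
have n1n l : (n1 l <= n)%N.
  apply: leq_trans Nn; rewrite /N (bigD1 l) //=; lia.
have nR : 0 < n%:R :> R by rewrite ltr0n; move: Nn; rewrite /N; lia.
have en : 1 <= n%:R * e.
  have /archi_boundP/ltW ie : 0 <= e^-1 by rewrite invr_ge0 ltW.
  rewrite -ler_pdivrMr // mul1r (le_trans ie) // ler_nat (leq_trans _ Nn) //.
  by rewrite /N; lia.
pose cnt l k := (\sum_(0 <= t < k) success I D S l t%:Z)%N.
(* The quota of [l]: its exact share rounded down, capped by the successes available before [n]. *)
pose m l := minn (cnt l n) (Num.truncn (n%:R * Rv l)).
have /choice [tau tauP] : forall l, exists k, (k <= n)%N /\ cnt l k = m l.
  move=> l; have [k kn km] := @exists_prefix_sum (fun t => success I D S l t%:Z) n (m l) (geq_minl _ _).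
  by exists k.
exists (fun l t => success I D S l t && (t < (tau l)%:Z)).
  apply: collision_free_sub (collision_free_success I D S).
  by move=> l t /andP [].
move=> l.
have -> : \sum_(0 <= t < n) (success I D S l t%:Z && (t%:Z < (tau l)%:Z))%:R =
    (m l)%:R :> R.
  have [tn <-] := tauP l; rewrite /cnt natr_sum.
  rewrite (@big_cat_nat _ _ _ (tau l)) //= [X in _ + X]big_nat_cond.
  rewrite [X in _ + X]big1 => [|t]; last first.
    by rewrite andbT => /andP [tt _]; rewrite ltz_nat ltnNge tt andbF.
  rewrite addr0; apply: eq_big_nat => t /andP [_ tt].
  by rewrite ltz_nat tt andbT.
have nRv : 0 <= n%:R * Rv l by rewrite mulr_ge0 // ltW.
have /andP [tr1 tr2] := truncn_itv nRv.
have mle : (m l)%:R <= n%:R * Rv l.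
  by apply: le_trans tr1; rewrite ler_nat geq_minr.
(* If the cap applies, the average success is already at least [Rv l - e]; otherwise rounding loses
   less than one transmission. *)
have mge : n%:R * (Rv l - e) <= (m l)%:R.
  rewrite /m /minn; case: ifP => _.
    have := n1P l n (n1n l); rewrite /avg_success -(ler_pM2l nR).
    by rewrite mulrA divff ?gt_eqF // mul1r natr_sum.
  move: tr2; rewrite -natr1; lra.
rewrite -(ler_pM2l nR) -{1}[n%:R](gtr0_norm nR) -normrM mulrBr mulrA divff ?gt_eqF // mul1r.
rewrite ler_norml; lra.
Qed.

(** The cycles in the walk of the first [N] blocks are weighted by their share of these blocks. The
    repetition-free remainder has at most as many blocks as there are matrices, whence the error
    bound. *)
Lemma graph_region_mean (S : schedule L) (N : nat) : (0 < N)%N -> collision_free I D S ->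
  exists2 Rv, region Rv & forall l,
    `|(N * T)%:R^-1 * \sum_(0 <= t < N * T) (S l t%:Z)%:R - Rv l| <=
      #|{: mat L T}|%:R / N%:R.
Proof.
move=> N0 cfS.
have TR : 0 < T%:R :> R by rewrite ltr0n.
have NR : 0 < N%:R :> R by rewrite ltr0n.
pose b k := block S T k.
have bpath k m : path (edgeb I D T) (b k) [seq b i | i <- iota k.+1 m].
  elim: m k => //= m IH k; rewrite IH andbT; apply/asboolP; exact: edge_block.
have [cs [u [csC uu _ sE]]] := path_cycle_decomposition I D T _ _ (bpath 0%N N.-1).
set u' := b 0%N :: u in uu sE.
have {}sE : perm_eq [seq b i | i <- iota 0 N] (flatten cs ++ u').
  by rewrite -(prednK N0).
have su : (size u' <= #|{: mat L T}|)%N.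
  by rewrite -(card_uniqP uu); exact: max_card.
have sumE (h : mat L T -> R) :
    \sum_(0 <= k < N) h (b k) = \sum_(c <- cs) \sum_(A <- c) h A + \sum_(A <- u') h A.
  rewrite -big_flatten -big_cat /= -(perm_big _ sE) big_map.
  by rewrite /index_iota subn0.
have NE : N%:R = \sum_(c <- cs) (size c)%:R + (size u')%:R :> R.
  have := sumE (fun=> 1); rewrite big_const_nat iter_addr_0 subn0 => ->.
  congr (_ + _); last by rewrite -sum1_size natr_sum.
  by apply: eq_bigr => c _; rewrite -sum1_size natr_sum.
(* The share of the remainder goes to the loop at the zero block, of rate 0, so that the weights sum
   to 1. *)
pose ps : seq (R * seq (mat L T)) :=
  ((size u')%:R / N%:R, [:: z]) :: [seq ((size c)%:R / N%:R, c) | c <- cs].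
exists (fun l => \sum_(p <- ps) p.1 * cycle_rate R p.2 l).
  apply: graph_region_seq.
    move=> p; rewrite inE => /orP [/eqP ->|/mapP [c ccs ->]] /=.
      by split; [rewrite divr_ge0 ?ler0n|exact: is_cycle_zero].
    by split; [rewrite divr_ge0 ?ler0n|exact: csC].
  rewrite big_cons big_map /= -mulr_suml -mulrDl addrC -NE divff //.
  by rewrite gt_eqF.
move=> l; rewrite big_cons big_map /=.
have -> : cycle_rate R [:: z] l = 0.
  by rewrite /cycle_rate big_seq1 [X in _ * X](g_zero l) mulr0.
rewrite mulr0 add0r.
have -> : \sum_(c <- cs) (size c)%:R / N%:R * cycle_rate R c l =
    (N * T)%:R^-1 * \sum_(c <- cs) \sum_(A <- c) g l A.
  rewrite mulr_sumr big_seq [RHS]big_seq; apply: eq_bigr => c /csC [c0 _].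
  rewrite /g sum_cycle_rate // natrM; field.
  by rewrite !gt_eqF.
(* The cycles cancel; the difference is the contribution of the remainder alone. *)
rewrite sum_blocks -(big_mkord xpredT (fun k => g l (b k))) sumE mulrDr addrAC subrr add0r.
have gu0 : 0 <= \sum_(A <- u') g l A by apply: sumr_ge0.
rewrite ger0_norm; last by rewrite mulr_ge0 ?invr_ge0 ?ler0n.
have gu1 : \sum_(A <- u') g l A <= #|{: mat L T}|%:R * T%:R.
  apply: (@le_trans _ _ (\sum_(A <- u') T%:R)).
    by apply: ler_sum => A _; exact: g_le.
  rewrite big_const_seq count_predT iter_addr_0 -[leLHS]mulr_natl.
  by rewrite ler_pM2r // ler_nat.
rewrite mulrC ler_pdivrMr ?natrM ?mulr_gt0 //.
apply: (le_trans gu1).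
by rewrite mulrA divfK // gt_eqF.
Qed.

Lemma achievable_graph_region : achievable_set `<=` region.
Proof.
move=> Rv RvA; apply: graph_region_closed => e e0.
have e2 : 0 < e / 2 by lra.
(* Half of [e] pays for the truncation; from [n0] blocks on, the other half covers the remainder of
   the walk. *)
pose n0 := (Num.bound (#|{: mat L T}|%:R / (e / 2))).+1.
have [N n0N [S cfS SE]] := achievable_truncation _ n0 RvA e2.
have N0 : (0 < N)%N by apply: leq_trans n0N.
have [Rv' RvG RvE] := graph_region_mean _ _ N0 cfS.
exists Rv' => // l; apply: le_trans (ler_distD _ _ _) _.
have : #|{: mat L T}|%:R / N%:R <= e / 2.
  rewrite ler_pdivrMr ?ltr0n // mulrC -ler_pdivrMr //.
  have /archi_boundP/ltW ME : 0 <= #|{: mat L T}|%:R / (e / 2).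
    by rewrite divr_ge0 ?ler0n // ltW.
  by rewrite (le_trans ME) // ler_nat ltnW.
have := RvE l; have := SE l; lra.
Qed.

End Regions.

Theorem theorem7 (R : realType) (L : finType) (I : L -> {set {set L}})
    (D : L -> L -> int)
    (HL : (0 < #|L|)%N)
    (HI : forall l phi, phi \in I l -> phi != finset.set0)
    (T : nat) (HT : (maxn (2 * character I D) 1 <= T)%N) :
  @graph_region L I D R T `<=` @achievable L I D R /\
  @achievable L I D R = @graph_region L I D R T.
Proof.
have GA := @graph_region_achievable R L I D T HT.
split=> //; apply/seteqP; split=> //.
exact: (@achievable_graph_region R L I D T HT).
Qed.
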